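(* Let $\mathsf{f}:\mathbb{N}\to\mathbb{N}$ be a complexity function and let $\Phi_\ell^{\mathsf{f}}$ be the learner. There exist two constants $k_1,k_2\in\mathbb{N}$ such that for every pair $(w,p)$ in the $\mathsf{f}$-Teaching Book, $$K(p)\le \delta(w)+k_1\quad\text{and}\quad K(w)\le \ell(p)+k_2 .$$
   Context: Languages and programs. $L$ is a universal (Turing-complete) language whose programs are finite sequences of instructions from a finite alphabet $\Upsilon$, each instruction coded with the same number $\log_2|\Upsilon|$ of bits. Let $\Sigma=\{0,1\}^*$. For a program $p$, $\dot\ell(p)$ is its length in number of instructions and $\ell(p)$ its length in bits. $\prec$ is the total order on programs given first by length and then, for equal length, by lexicographic order over $\Upsilon$. A program $p$ computes a map $\Sigma\to\Sigma\cup\{\perp\}$, where $p(\mathtt i)=\perp$ means that $p$ does not halt on $\mathtt i$. An $L$-concept is a function $c:\Sigma\to\Sigma\cup\{\perp\}$ computed by at least one program of $L$; $C_L$ is the set of $L$-concepts and $[c]_L$ the set of programs of $L$ computing $c$. Examples. $X=\Sigma\times(\Sigma\cup\{\perp\})$. An example set is a finite subset $S=\{\langle \mathtt i_j,\mathtt o_j\rangle\}_{j=1}^k$ of $X$ without different outputs for equal inputs. $\delta(S)$ is the number of bits of the encoding of $S$ by a fixed prefix (self-delimiting) code, e.g. based on Elias coding. $\lessdot$ is a fixed total order on example sets such that $S\lessdot S'$ implies $\delta(S)\le\delta(S')$. Time-bounded compatibility. $\lambda_L(\mathtt i,S)$ is a time bound (in steps, for input $\mathtt i$), of the form $\rho\cdot\min\{\ell(\mathtt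 i),\ell(\mathtt i_{max})\}+\ell(\mathtt o_{max})$ with $\rho$ a constant and $\mathtt i_{max},\mathtt o_{max}$ the longest input and output in $S$, that suffices for a program hard-coding $S$ as a trie (lookup table). A complexity function is a function $\mathsf f:\mathbb N\to\mathbb N$ acting as a time bound. $p\vDash_{\mathsf f}S$ ($p$ is $\mathsf f$-compatible with $S$) means that for each $\langle \mathtt i,\mathtt o\rangle\in S$, within $\max\{\mathsf f(\ell(\mathtt i)),\lambda_L(\mathtt i,S)\}$ time steps, $p$ on input $\mathtt i$ outputs $\mathtt o$ if $\mathtt o\ne\perp$, and does not halt if $\mathtt o=\perp$. Learner, teacher, Teaching Book. The learner is $\Phi_\ell^{\mathsf f}(S)=$ the $\prec$-first program $p$ of $L$ with $p\vDash_{\mathsf f}S$. The teacher is $\Omega_\ell^{\mathsf f}(c)=$ the $\lessdot$-first example set $S$ with $\Phi_\ell^{\mathsf f}(S)\in[c]_L$. The teaching size is $TS_\ell^{\mathsf f}(c)=\delta(\Omega_\ell^{\mathsf f}(c))$. The $\mathsf f$-Teaching Book consists of the pairs $(w_c,p_c)$ with $w_c=\Omega_\ell^{\mathsf f}(c)$ and $p_c=\Phi_\ell^{\mathsf f}(w_c)\in[c]_L$, for those concepts $c$ for which such a witness set exists, listed in the order of $w_c$; no program and no witness set is repeated. Kolmogorov complexity. $K=K_U$ is the standard Kolmogorov complexity with respect to a universal (monotone) machine $U$, applied to the binary strings encoding programs and example sets; the statement holds for any universal $U$.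
   Formalization: The complexity function f, the decoder of the prefix code and the order on example sets are assumed computable, and K is plain Kolmogorov complexity rather than that of a monotone machine; without these the inequalities fail for some L. *)

(* Defs.v *)
From HB Require Import structures.
From Stdlib Require Import Reals.
From mathcomp Require Import all_boot all_order.
From mathcomp Require Import finmap.

Set Implicit Arguments.
Unset Strict Implicit.
Unset Printing Implicit Defensive.

Delimit Scope R_scope with coqR.

Notation word := (seq bool).

(** * Computability

    The model is the language I of N. D. Jones (Computability and Complexity
    from a Programming Perspective, MIT Press 1997): a while language with a
    single variable, ranging over binary trees.  It is Turing-complete. *)

Inductive data := Nil | Cons of data & data.

Definition hd (x : data) := if x is Cons a _ then a else Nil.
Definition tl (x : data) := if x is Cons _ b then b else Nil.

Inductive expr := EVar | ENil | ECons of expr & expr | EHd of expr | ETl of expr.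

Inductive cmd := Assign of expr | Seq of cmd & cmd | While of expr & cmd.

Fixpoint eval (e : expr) (x : data) : data :=
  match e with
  | EVar => x
  | ENil => Nil
  | ECons e1 e2 => Cons (eval e1 x) (eval e2 x)
  | EHd e1 => hd (eval e1 x)
  | ETl e1 => tl (eval e1 x)
  end.

(** [exec C x y]: started with the variable equal to [x], the command [C]
    terminates with the variable equal to [y]. *)
Inductive exec : cmd -> data -> data -> Prop :=
  | ExecAssign e x : exec (Assign e) x (eval e x)
  | ExecSeq C1 C2 x y z : exec C1 x y -> exec C2 y z -> exec (Seq C1 C2) x z
  | ExecWhileStop e C x : eval e x = Nil -> exec (While e C) x x
  | ExecWhileLoop e C x y z : eval e x <> Nil ->
      exec C x y -> exec (While e C) y z -> exec (While e C) x z.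

Class coded (A : Type) := code : A -> data.

#[global] Instance coded_bool : coded bool :=
  fun b => if b then Cons Nil Nil else Nil.
#[global] Instance coded_nat : coded nat :=
  fun n => iter n (Cons Nil) Nil.
#[global] Instance coded_option A `{coded A} : coded (option A) :=
  fun x => if x is Some a then Cons (code a) Nil else Nil.
#[global] Instance coded_prod A B `{coded A} `{coded B} : coded (A * B) :=
  fun x => Cons (code x.1) (code x.2).
#[global] Instance coded_seq A `{coded A} : coded (seq A) :=
  foldr (fun a => Cons (code a)) Nil.
#[global] Instance coded_fin (T : finType) : coded T | 100 :=
  fun x => code (nat_of_ord (enum_rank x)).

Definition computable A B `{coded A} `{coded B} (g : A -> B) : Prop :=
  exists C, forall a, exec C (code a) (code (g a)).

(** A partial function on words is a function into [option word], with value
    [None] where it is undefined. *)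
Definition pcomputable (phi : word -> option word) : Prop :=
  exists C, forall i d, exec C (code i) d <-> omap code (phi i) = Some d.

(** * Kolmogorov complexity *)

(** Every other machine is simulated at the price of a constant number of
    additional bits.  This covers machines such that for each [phi] there is a
    word [s] with [U (s ++ q) = phi q] for all [q]. *)
Record universal_machine := UniversalMachine {
  machine :> word -> option word;
  machine_pcomputable : pcomputable machine;
  machine_universal : forall phi, pcomputable phi -> exists c : nat,
    forall q x, phi q = Some x ->
      exists2 q', machine q' = Some x & size q' <= size q + c }.

Lemma description_exists (U : universal_machine) (x : word) :
  exists n, [exists q : n.-tuple bool, U q == Some x].
Proof.
have cid : pcomputable Some.
  exists (Assign EVar) => i d; split=> [E|[<-]]; last exact: ExecAssign EVar _.
  by inversion E.
have [c /(_ x x erefl)[q Uq _]] := machine_universal U cid.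
by exists (size q); apply/existsP; exists (in_tuple q); rewrite Uq.
Qed.

Definition K (U : universal_machine) (x : word) : nat :=
  ex_minn (description_exists U x).

(** * Example sets *)

(** The output [None] stands for non-termination. *)
Notation example := (word * option word)%type.

Definition single_valued (S : {fset example}) : bool :=
  all2rel (fun x y : example => (x.1 == y.1) ==> (x.2 == y.2)) S.

Record exset := ExSet { examples :> {fset example}; _ : single_valued examples }.

Definition input_le (x y : example) : bool :=
  Order.le (x.1 : seqlexi bool) (y.1 : seqlexi bool).

(** The inputs of an example set are pairwise distinct, so sorting by input
    determines a unique listing. *)
#[global] Instance coded_exset : coded exset :=
  fun S => code (sort input_le (enum_fset S)).

(** The code is effective: the decoder is total and computable, hence the set of
    code words is decidable. *)
Record prefix_code := PrefixCode {
  enc : exset -> word;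
  dec : word -> option exset;
  encK : pcancel enc dec;
  decK : ocancel dec enc;
  enc_prefix_free : forall S S', prefix (enc S) (enc S') -> S = S';
  dec_computable : computable dec }.

Definition delta (E : prefix_code) (S : exset) : nat := size (enc E S).

Record example_order (E : prefix_code) := ExampleOrder {
  exle :> rel exset;
  exle_anti : antisymmetric exle;
  exle_trans : transitive exle;
  exle_total : total exle;
  exle_delta : forall S S', exle S S' -> delta E S <= delta E S';
  exle_computable : computable (fun x : exset * exset => exle x.1 x.2) }.

Definition imax (S : exset) : nat := \max_(x <- enum_fset S) size x.1.
Definition omax (S : exset) : nat :=
  \max_(x <- enum_fset S) size (odflt [::] x.2).

(** * Languages *)

Definition lookup_time (rho : nat) (i : word) (S : exset) : nat :=
  rho * minn (size i) (imax S) + omax S.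

(** [run p i t = Some o]: program [p] on input [i] halts within [t] steps with
    output [o]; [run p i t = None]: it does not halt within [t] steps. *)
Record language (disp : Order.disp_t) (Ups : finOrderType disp) := Language {
  is_program : pred (seq Ups);
  run : seq Ups -> word -> nat -> option word;
  rho : nat;
  instr_gt1 : 1 < #|Ups|;
  is_program_computable : computable is_program;
  run_computable :
    computable (fun x : seq Ups * word * nat => run x.1.1 x.1.2 x.2);
  run_monotone : forall p i t t' o,
    t <= t' -> run p i t = Some o -> run p i t' = Some o;
  turing_complete : forall phi, pcomputable phi ->
    exists2 p, is_program p &
      forall i o, phi i = Some o <-> exists t, run p i t = Some o;
  (* some program hard-codes S within the time bound *)
  lookup_program : forall S : exset, exists2 p, is_program p &
    forall i o, (i, o) \in examples S ->
      if o is Some y then run p i (lookup_time rho i S) = Some y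
      else forall t, run p i t = None }.

(** Programs are encoded with blocks of equal length, the least sufficient one. *)
Definition instr_bits (disp : Order.disp_t) (Ups : finOrderType disp)
    (a : Ups) : word :=
  mkseq (fun j => odd (enum_rank a %/ 2 ^ j)) (up_log 2 #|Ups|).

Definition program_bits (disp : Order.disp_t) (Ups : finOrderType disp)
    (p : seq Ups) : word :=
  flatten [seq instr_bits a | a <- p].

(** [log2 #|Ups|] bits per instruction: this is [size (program_bits p)] when
    [#|Ups|] is a power of two, and is smaller otherwise. *)
Definition ell (disp : Order.disp_t) (Ups : finOrderType disp)
    (p : seq Ups) : R :=
  (INR (size p) * (ln (INR #|Ups|) / ln 2))%coqR.

Definition prog_le (disp : Order.disp_t) (Ups : finOrderType disp)
    (p q : seq Ups) : bool :=
  (size p < size q) ||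
  (size p == size q) && Order.le (p : seqlexi Ups) (q : seqlexi Ups).

(** * Teaching *)

Definition first (T : Type) (le : rel T) (P : T -> Prop) (x : T) : Prop :=
  P x /\ forall y, P y -> le x y.

Section Teaching.
Variables (disp : Order.disp_t) (Ups : finOrderType disp) (L : language Ups).
Variables (E : prefix_code) (O : example_order E) (f : nat -> nat).

Definition computes (p : seq Ups) (c : word -> option word) : Prop :=
  is_program L p /\
  forall i o, c i = Some o <-> exists t, run L p i t = Some o.

Definition compatible (p : seq Ups) (S : exset) : Prop :=
  forall i o, (i, o) \in examples S ->
    run L p i (maxn (f (size i)) (lookup_time (rho L) i S)) = o.

(** The graph of the learner. *)
Definition learner (S : exset) (p : seq Ups) : Prop :=
  first (@prog_le _ Ups) (fun q => is_program L q /\ compatible q S) p.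

(** The graph of the teacher. *)
Definition teacher (c : word -> option word) (S : exset) : Prop :=
  first O (fun S' => exists2 p, learner S' p & computes p c) S.

Definition teaching_book (w : exset) (p : seq Ups) : Prop :=
  exists c, [/\ teacher c w, learner w p & computes p c].

End Teaching.

(* Main.v *)
From Stdlib Require Import Reals Lra ClassicalEpsilon.
From mathcomp Require Import all_boot all_order finmap zify.
Require Import Defs.

Set Implicit Arguments.
Unset Strict Implicit.
Unset Printing Implicit Defensive.

(** The learner is a total computable function, since a program hard-coding the
    examples always fits them: decoding [w], learning from it and encoding the
    result describes [p] from the code word of [w].

    Conversely [w] is the [exle]-first example set from which [p] is learnt: any
    other such set [S] teaches the concept of [p], so the teacher ranks [w] before
    it.  As the size of code words grows along [exle], searching code words by
    size finds [w] from the position of [p] in the program order, and for a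
    program of length [n] over [m] instructions this position is below [2 * m ^ n],
    hence has a binary description of at most [n * log2 m + 1] bits. *)

(** * Semantics of the while language: inversion and determinism *)

Lemma exec_seqE C1 C2 x z :
  exec (Seq C1 C2) x z -> exists2 y, exec C1 x y & exec C2 y z.
Proof. by move=> E; inversion E; subst; exists y. Qed.

Lemma exec_whileE e C x z : exec (While e C) x z ->
  (eval e x = Nil /\ z = x) \/
  (eval e x <> Nil /\ exists2 y, exec C x y & exec (While e C) y z).
Proof.
by move=> E; inversion E; subst; [left | right; split=> //; exists y].
Qed.

(** In each state at most one rule applies to a command. Determinism upgrades the one-sided
    [computable] to the equivalence in [pcomputable] and lets runs be traced backwards. *)
Lemma exec_det C x y z : exec C x y -> exec C x z -> y = z.
Proof.
move=> Exy; elim: Exy z => {C x y}.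
- by move=> e x z E; inversion E.
- by move=> C1 C2 x y z _ IH1 _ IH2 z' /exec_seqE[y' /IH1 <- /IH2].
- by move=> e C x ex z /exec_whileE[[_ ->]|[]].
- move=> e C x y z ex _ IH1 _ IH2 z' /exec_whileE[[/ex]|[_ [y' /IH1 <- /IH2]]] //.
Qed.

(** * Building commands: auxiliary storage, constants and branching *)

Fixpoint expr_subst (s e : expr) : expr :=
  match e with
  | EVar => s
  | ENil => ENil
  | ECons e1 e2 => ECons (expr_subst s e1) (expr_subst s e2)
  | EHd e1 => EHd (expr_subst s e1)
  | ETl e1 => ETl (expr_subst s e1)
  end.

Lemma eval_subst s e x : eval (expr_subst s e) x = eval e (eval s x).
Proof. by elim: e => //= [e1 -> e2 ->|e ->|e ->]. Qed.

(** The language has a single variable, so auxiliary data wait in the tail of the state while a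
    command works on the head. *)
Fixpoint on_hd (C : cmd) : cmd :=
  match C with
  | Assign e => Assign (ECons (expr_subst (EHd EVar) e) (ETl EVar))
  | Seq C1 C2 => Seq (on_hd C1) (on_hd C2)
  | While e C1 => While (expr_subst (EHd EVar) e) (on_hd C1)
  end.

Lemma exec_on_hd C x y z : exec C x y -> exec (on_hd C) (Cons x z) (Cons y z).
Proof.
elim=> {C x y}.
- move=> e x /=.
  have := ExecAssign (ECons (expr_subst (EHd EVar) e) (ETl EVar)) (Cons x z).
  by rewrite /= eval_subst.
- by move=> *; apply: ExecSeq; eassumption.
- by move=> e C x ex; apply: ExecWhileStop; rewrite eval_subst.
- move=> e C x y w ex _ IH1 _ IH2; apply: ExecWhileLoop IH1 IH2.
  by rewrite eval_subst.
Qed.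

Fixpoint quote (d : data) : expr :=
  if d is Cons a b then ECons (quote a) (quote b) else ENil.

Lemma eval_quote d x : eval (quote d) x = d.
Proof. by elim: d => //= a -> b ->. Qed.

Lemma exec_assign e x y : eval e x = y -> exec (Assign e) x y.
Proof. by move=> <-; apply: ExecAssign. Qed.

(* State [Cons v (Cons to_do_1 to_do_2)]: each loop runs at most once, since its
   body clears both flags. *)
Definition branch (C1 C2 : cmd) : cmd :=
  let clear := Assign (ECons (EHd EVar) (ECons ENil ENil)) in
  Seq (Assign (ECons EVar (ECons (EHd EVar) (ECons ENil ENil))))
   (Seq (While (EHd (ETl EVar)) (Seq (on_hd C1) clear))
    (Seq (While (ETl (ETl EVar)) (Seq (on_hd (Seq (Assign (ETl EVar)) C2)) clear))
     (Assign (EHd EVar)))).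

Lemma exec_branch_cons C1 C2 d x y :
  d <> Nil -> exec C1 (Cons d x) y -> exec (branch C1 C2) (Cons d x) y.
Proof.
move=> dN E1; apply: ExecSeq; first exact: ExecAssign.
apply: ExecSeq => /=.
  apply: ExecWhileLoop => //=.
    by apply: ExecSeq; [apply: exec_on_hd E1 | apply: ExecAssign].
  exact: ExecWhileStop.
by apply: ExecSeq; [apply: ExecWhileStop | apply: ExecAssign].
Qed.

Lemma exec_branch_nil C1 C2 x y :
  exec C2 x y -> exec (branch C1 C2) (Cons Nil x) y.
Proof.
move=> E2; apply: ExecSeq; first exact: ExecAssign.
apply: ExecSeq => /=; first exact: ExecWhileStop.
apply: ExecSeq; last exact: (ExecAssign (EHd EVar) (Cons y (Cons Nil Nil))).
(* [z] holds the flags after the skipped first loop: the first is off, the second on. *)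
pose z := Cons Nil (Cons Nil Nil).
apply: (@ExecWhileLoop _ _ _ (Cons y (Cons Nil Nil))) => //=;
  last exact: ExecWhileStop.
apply: (@ExecSeq _ _ _ (Cons y z)); last exact: exec_assign.
apply: (@ExecSeq _ _ _ (Cons x z)); [exact: exec_assign | exact: exec_on_hd].
Qed.

(** With this choice a list of [n] units and the number [n] have the same code. *)
#[global] Instance coded_unit : coded unit := fun _ => Nil.

(** * Closure of computable functions under pairing, case analysis and folds *)

Section Closure.
Context {A : Type} {cA : coded A}.

Lemma comp_expr {B} {cB : coded B} (g : A -> B) e :
  (forall a, eval e (code a) = code (g a)) -> computable g.
Proof. by move=> eg; exists (Assign e) => a; apply: exec_assign. Qed.

Lemma comp_cst {B} {cB : coded B} (b : B) : computable (fun _ : A => b).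
Proof. by apply: (comp_expr (e := quote (code b))) => a; apply: eval_quote. Qed.

Lemma comp_id : computable (fun a : A => a).
Proof. exact: (comp_expr (e := EVar)). Qed.

Lemma comp_comp {B C} {cB : coded B} {cC : coded C} (g : B -> C) (F : A -> B) :
  computable g -> computable F -> computable (fun a => g (F a)).
Proof.
move=> [Cg Eg] [CF EF]; exists (Seq CF Cg) => a.
exact: ExecSeq (EF a) (Eg (F a)).
Qed.

Lemma comp_ext {B} {cB : coded B} (F G : A -> B) :
  F =1 G -> computable F -> computable G.
Proof. by move=> FG [C E]; exists C => a; rewrite -FG. Qed.

(** The input is duplicated; [CG] runs on one copy while the other waits in the tail, then the two
    are swapped and [CF] runs. *)
Lemma comp_pair {B C} {cB : coded B} {cC : coded C} (F : A -> B) (G : A -> C) :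
  computable F -> computable G -> computable (fun a => (F a, G a)).
Proof.
move=> [CF EF] [CG EG].
pose swap := Assign (ECons (ETl EVar) (EHd EVar)).
exists (Seq (Assign (ECons EVar EVar)) (Seq (on_hd CG) (Seq swap (on_hd CF)))).
move=> a; apply: ExecSeq; first exact: ExecAssign.
apply: ExecSeq; first exact: exec_on_hd (EG a).
apply: (@ExecSeq _ _ _ (Cons (code a) (code (G a)))); first exact: exec_assign.
exact: (exec_on_hd _ (EF a)).
Qed.

End Closure.

(** Each branch need be correct only on inputs that reach it, so it may take apart a value whose
    shape the test has established. Testing for [Nil] serves Booleans, options and lists alike:
    [false], [None] and [[::]] are all coded by [Nil]. *)
Lemma comp_branch {A B} {cA : coded A} {cB : coded B} (e : expr) (t : A -> bool)
    (g : A -> B) CG CH :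
  (forall a, t a <-> eval e (code a) <> Nil) ->
  (forall a, t a -> exec CG (code a) (code (g a))) ->
  (forall a, ~~ t a -> exec CH (code a) (code (g a))) ->
  computable g.
Proof.
move=> te EG EH.
(* [branch] hands the test value on to its first command only, hence the [ETl] there. *)
exists (Seq (Assign (ECons e EVar)) (branch (Seq (Assign (ETl EVar)) CG) CH)) => a.
apply: ExecSeq; first exact: ExecAssign; rewrite /=.
have [ta|ta] := boolP (t a).
  apply: exec_branch_cons; first exact/te.
  by apply: ExecSeq (EG a ta); apply: exec_assign.
suff -> : eval e (cA a) = Nil by apply: exec_branch_nil; apply: EH.
case E: (eval e (cA a)) => [|u v] //.
by case/negP: ta; apply/(te a); rewrite /code E.
Qed.

Section Cases.
Context {A B : Type} {cA : coded A} {cB : coded B}.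

Lemma comp_if (b : A -> bool) (F G : A -> B) :
  computable b -> computable F -> computable G ->
  computable (fun a => if b a then F a else G a).
Proof.
move=> cb [CF EF] [CG EG].
have cp : computable (fun a => (b a, a)) by apply: comp_pair => //; apply: comp_id.
apply: (comp_comp (g := fun x : bool * A => if x.1 then F x.2 else G x.2) _ cp).
apply: (comp_branch (e := EHd EVar) (t := fst) (CG := Seq (Assign (ETl EVar)) CF)
  (CH := Seq (Assign (ETl EVar)) CG)); first by case=> [[] a].
- move=> [[] a] //= _; apply: ExecSeq (EF a); exact: exec_assign.
- move=> [[] a] //= _; apply: ExecSeq (EG a); exact: exec_assign.
Qed.

Lemma comp_option {C} {cC : coded C}
    (F : A -> option C) (G : A -> C -> B) (H : A -> B) :
  computable F -> computable (fun x => G x.1 x.2) -> computable H ->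
  computable (fun a => if F a is Some c then G a c else H a).
Proof.
move=> cF [CG EG] [CH EH].
have cp : computable (fun a => (F a, a)) by apply: comp_pair => //; apply: comp_id.
apply: (comp_comp (g := fun x : option C * A =>
  if x.1 is Some c then G x.2 c else H x.2) _ cp).
apply: (comp_branch (e := EHd EVar) (t := fun x : option C * A => isSome x.1)
  (CG := Seq (Assign (ECons (ETl EVar) (EHd (EHd EVar)))) CG)
  (CH := Seq (Assign (ETl EVar)) CH)); first by case=> [[c|] a].
- move=> [[c|] a] //= _; apply: ExecSeq (EG (a, c)); exact: exec_assign.
- move=> [[c|] a] //= _; apply: ExecSeq (EH a); exact: exec_assign.
Qed.

Lemma comp_seq {C} {cC : coded C}
    (F : A -> seq C) (G : A -> C -> seq C -> B) (H : A -> B) :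
  computable F -> computable (fun x : A * (C * seq C) => G x.1 x.2.1 x.2.2) ->
  computable H ->
  computable (fun a => if F a is c :: s then G a c s else H a).
Proof.
move=> cF [CG EG] [CH EH].
have cp : computable (fun a => (F a, a)) by apply: comp_pair => //; apply: comp_id.
apply: (comp_comp (g := fun x : seq C * A =>
  if x.1 is c :: s then G x.2 c s else H x.2) _ cp).
apply: (comp_branch (e := EHd EVar) (t := fun x : seq C * A => ~~ nilp x.1)
  (CG := Seq (Assign (ECons (ETl EVar) (EHd EVar))) CG)
  (CH := Seq (Assign (ETl EVar)) CH)); first by case=> [[|c s] a].
- move=> [[|c s] a] //= _; apply: ExecSeq (EG (a, (c, s))); exact: exec_assign.
- move=> [[|c s] a] //= _; apply: ExecSeq (EH a); exact: exec_assign.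
Qed.

(* Loop state: [Cons s (Cons acc a)], with [s] the rest of the list. *)
Lemma comp_foldl {C} {cC : coded C} (F : A -> seq C) (G : A -> B)
    (step : A -> B -> C -> B) :
  computable F -> computable G ->
  computable (fun x : A * (B * C) => step x.1 x.2.1 x.2.2) ->
  computable (fun a => foldl (step a) (G a) (F a)).
Proof.
move=> cF cG [Cs Es].
have cp : computable (fun a => (F a, (G a, a))).
  by apply: comp_pair => //; apply: comp_pair => //; apply: comp_id.
apply: (comp_comp (g := fun x : seq C * (B * A) =>
  foldl (step x.2.2) x.2.1 x.1) _ cp).
pose s := EHd EVar; pose b := EHd (ETl EVar); pose a := ETl (ETl EVar).
pose load := Assign (ECons (ECons a (ECons b (EHd s))) (ECons (ETl s) a)).
pose store :=
  Assign (ECons (EHd (ETl EVar)) (ECons (EHd EVar) (ETl (ETl EVar)))).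
exists (Seq (While s (Seq load (Seq (on_hd Cs) store))) (Assign b)) => -[l [b0 a0]].
apply: (@ExecSeq _ _ _ (code ([::] : seq C, (foldl (step a0) b0 l, a0))));
  last exact: exec_assign.
elim: l b0 => [|c l IH] b0 /=; first exact: ExecWhileStop.
apply: (@ExecWhileLoop _ _ _ (code (l, (step a0 b0 c, a0)))) (IH _) => //.
apply: ExecSeq; first exact: ExecAssign.
apply: ExecSeq; first exact: exec_on_hd (Es (a0, (b0, c))).
exact: exec_assign.
Qed.

End Cases.

Lemma comp_comp2 {A B C D}
    {cA : coded A} {cB : coded B} {cC : coded C} {cD : coded D}
    (g : B -> C -> D) (F : A -> B) (G : A -> C) :
  computable (fun x : B * C => g x.1 x.2) -> computable F -> computable G ->
  computable (fun a => g (F a) (G a)).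
Proof.
move=> cg cF cG.
exact: (comp_comp (F := fun a => (F a, G a)) cg (comp_pair cF cG)).
Qed.

Section Projections.
Context {A B C : Type} {cA : coded A} {cB : coded B} {cC : coded C}.

Lemma comp_fst (F : A -> B * C) : computable F -> computable (fun a => (F a).1).
Proof. by apply: comp_comp; apply: (comp_expr (e := EHd EVar)). Qed.

Lemma comp_snd (F : A -> B * C) : computable F -> computable (fun a => (F a).2).
Proof. by apply: comp_comp; apply: (comp_expr (e := ETl EVar)). Qed.

Lemma comp_cons (F : A -> B) (G : A -> seq B) :
  computable F -> computable G -> computable (fun a => F a :: G a).
Proof.
move=> cF cG; apply: (comp_comp (g := fun x => x.1 :: x.2) _ (comp_pair cF cG)).
exact: (comp_expr (e := EVar)).
Qed.

End Projections.

(* Environments are nested pairs; this closes the goals that fetch a variable. *)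
Ltac comp_var :=
  cbv beta;
  lazymatch goal with
  | |- @computable _ _ _ _ (fun x => x) => apply: comp_id
  | |- @computable _ _ _ _ fst => exact: (comp_fst comp_id)
  | |- @computable _ _ _ _ snd => exact: (comp_snd comp_id)
  | |- @computable _ _ _ _ (fun x => fst (@?F x)) => refine (comp_fst _); comp_var
  | |- @computable _ _ _ _ (fun x => snd (@?F x)) => refine (comp_snd _); comp_var
  | |- _ => exact: comp_cst
  end.

(** * Computability of arithmetic, of list operations and of functions on finite types *)

Section Iteration.
Context {A B : Type} {cA : coded A} {cB : coded B}.

(** Numbers are coded in unary, so an iteration is a fold over a list of units. *)
Lemma comp_iter (F : A -> nat) (G : A -> B) (step : A -> B -> B) :
  computable F -> computable G -> computable (fun x : A * B => step x.1 x.2) ->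
  computable (fun a => iter (F a) (step a) (G a)).
Proof.
move=> cF cG cs.
apply: (comp_ext (F := fun a =>
  foldl (fun b (_ : unit) => step a b) (G a) (nseq (F a) tt))).
  by move=> a; elim: (F a) (G a) => //= n IH b; rewrite IH -iterSr.
apply: comp_foldl => //.
  apply: (comp_comp (g := fun n => nseq n tt)) => //.
  by apply: (comp_expr (e := EVar)); elim=> //= n; rewrite /code /= => ->.
by refine (comp_comp2 cs _ _); comp_var.
Qed.

End Iteration.

Lemma comp_andb {A} {cA : coded A} (b c : A -> bool) :
  computable b -> computable c -> computable (fun a => b a && c a).
Proof. by move=> cb cc; apply: comp_if => //; apply: comp_cst. Qed.

Lemma comp_succn {A} {cA : coded A} (F : A -> nat) :
  computable F -> computable (fun a => (F a).+1).
Proof. by apply: comp_comp; apply: (comp_expr (e := ECons ENil EVar)). Qed.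

Lemma comp_predn {A} {cA : coded A} (F : A -> nat) :
  computable F -> computable (fun a => (F a).-1).
Proof. by apply: comp_comp; apply: (comp_expr (e := ETl EVar)); case. Qed.

Lemma comp_addn {A} {cA : coded A} (F G : A -> nat) :
  computable F -> computable G -> computable (fun a => F a + G a).
Proof.
move=> cF cG; apply: (comp_ext (F := fun a => iter (F a) succn (G a))).
  by move=> a; rewrite iter_succn addnC.
by apply: comp_iter => //; apply: comp_succn; comp_var.
Qed.

Lemma comp_subn {A} {cA : coded A} (F G : A -> nat) :
  computable F -> computable G -> computable (fun a => F a - G a).
Proof.
move=> cF cG; apply: (comp_ext (F := fun a => iter (G a) predn (F a))).
  by move=> a; apply: iter_predn.
by apply: comp_iter => //; apply: comp_predn; comp_var.
Qed.

Lemma comp_muln {A} {cA : coded A} (F G : A -> nat) :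
  computable F -> computable G -> computable (fun a => F a * G a).
Proof.
move=> cF cG; apply: (comp_ext (F := fun a => iter (F a) (addn (G a)) 0)).
  by move=> a; rewrite iter_addn_0 mulnC.
apply: comp_iter => //; first exact: comp_cst.
apply: (comp_addn (F := fun x : A * nat => G x.1)); last comp_var.
by apply: comp_comp => //; comp_var.
Qed.

Lemma comp_maxn {A} {cA : coded A} (F G : A -> nat) :
  computable F -> computable G -> computable (fun a => maxn (F a) (G a)).
Proof.
move=> cF cG; apply: (comp_ext (F := fun a => F a + (G a - F a))).
  by move=> a; rewrite maxnE.
by apply: comp_addn => //; apply: comp_subn.
Qed.

Lemma comp_minn {A} {cA : coded A} (F G : A -> nat) :
  computable F -> computable G -> computable (fun a => minn (F a) (G a)).
Proof.
move=> cF cG; apply: (comp_ext (F := fun a => F a - (F a - G a))).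
  by move=> a; rewrite minnE.
by apply: comp_subn => //; apply: comp_subn.
Qed.

Lemma comp_leq {A} {cA : coded A} (F G : A -> nat) :
  computable F -> computable G -> computable (fun a => F a <= G a).
Proof.
move=> cF cG.
apply: (comp_comp (g := fun n => n == 0)); last exact: comp_subn.
apply: (comp_ext (F := fun n => iter n (fun=> false) true)); first by case.
by apply: comp_iter; comp_var.
Qed.

Lemma comp_eqn {A} {cA : coded A} (F G : A -> nat) :
  computable F -> computable G -> computable (fun a => F a == G a).
Proof.
move=> cF cG; apply: (comp_ext (F := fun a => (F a <= G a) && (G a <= F a))).
  by move=> a; rewrite eqn_leq.
by apply: comp_andb; apply: comp_leq.
Qed.

Lemma comp_rev {A C} {cA : coded A} {cC : coded C} (F : A -> seq C) :
  computable F -> computable (fun a => rev (F a)).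
Proof.
move=> cF; apply: (comp_ext (F := fun a => foldl (fun s x => x :: s) [::] (F a))).
  move=> a; rewrite -[RHS]cats0 /rev.
  have: forall s t : seq C, foldl (fun s x => x :: s) t s = catrev s t by elim=> //=.
  by move=> ->; rewrite cats0.
by apply: comp_foldl => //; [apply: comp_cst | apply: comp_cons; comp_var].
Qed.

Lemma comp_foldr {A B C} {cA : coded A} {cB : coded B} {cC : coded C}
    (F : A -> seq C) (G : A -> B) (step : A -> C -> B -> B) :
  computable F -> computable G ->
  computable (fun x : A * (C * B) => step x.1 x.2.1 x.2.2) ->
  computable (fun a => foldr (step a) (G a) (F a)).
Proof.
move=> cF cG cs.
apply: (comp_ext (F := fun a => foldl (fun b c => step a c b) (G a) (rev (F a)))).
  by move=> a; rewrite foldl_rev.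
apply: comp_foldl => //; first exact: comp_rev.
apply: (comp_comp (F := fun x : A * (B * C) => (x.1, (x.2.2, x.2.1))) cs).
by do 2?apply: comp_pair; comp_var.
Qed.

Lemma comp_cat {A C} {cA : coded A} {cC : coded C} (F G : A -> seq C) :
  computable F -> computable G -> computable (fun a => F a ++ G a).
Proof.
move=> cF cG; apply: (comp_ext (F := fun a => foldr cons (G a) (F a))).
  by move=> a; elim: (F a) => //= x s ->.
by apply: comp_foldr => //; apply: comp_cons; comp_var.
Qed.

Lemma comp_flatten {A C} {cA : coded A} {cC : coded C} (F : A -> seq (seq C)) :
  computable F -> computable (fun a => flatten (F a)).
Proof.
move=> cF; apply: comp_foldr => //; first comp_var.
by apply: (comp_cat (F := fun x => x.2.1) (G := fun x => x.2.2)); comp_var.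
Qed.

Lemma comp_map {A B C} {cA : coded A} {cB : coded B} {cC : coded C}
    (F : A -> seq C) (g : A -> C -> B) :
  computable F -> computable (fun x : A * C => g x.1 x.2) ->
  computable (fun a => [seq g a c | c <- F a]).
Proof.
move=> cF cg.
apply: (comp_ext (F := fun a => foldr (fun c s => g a c :: s) [::] (F a))).
  by move=> a; elim: (F a) => //= x s ->.
apply: comp_foldr; [by []|comp_var|apply: comp_cons; last comp_var].
by refine (comp_comp2 cg _ _); comp_var.
Qed.

Lemma comp_filter {A C} {cA : coded A} {cC : coded C}
    (F : A -> seq C) (g : A -> C -> bool) :
  computable F -> computable (fun x : A * C => g x.1 x.2) ->
  computable (fun a => [seq c <- F a | g a c]).
Proof.
move=> cF cg.
apply: (comp_ext (F := fun a =>
  foldr (fun c s => if g a c then c :: s else s) [::] (F a))).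
  by move=> a; elim: (F a) => //= x s ->.
apply: comp_foldr; [by []|comp_var|].
apply: comp_if; [|apply: comp_cons; comp_var|comp_var].
by refine (comp_comp2 cg _ _); comp_var.
Qed.

Lemma comp_all {A C} {cA : coded A} {cC : coded C}
    (F : A -> seq C) (g : A -> C -> bool) :
  computable F -> computable (fun x : A * C => g x.1 x.2) ->
  computable (fun a => all (g a) (F a)).
Proof.
move=> cF cg.
apply: (comp_ext (F := fun a => foldr (fun c b => g a c && b) true (F a))).
  by move=> a; elim: (F a) => //= x s ->.
apply: comp_foldr; [by []|comp_var|apply: comp_andb; last comp_var].
by refine (comp_comp2 cg _ _); comp_var.
Qed.

Lemma comp_size {A C} {cA : coded A} {cC : coded C} (F : A -> seq C) :
  computable F -> computable (fun a => size (F a)).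
Proof.
move=> cF; apply: (comp_ext (F := fun a => foldr (fun=> succn) 0 (F a))).
  by move=> a; elim: (F a) => //= x s ->.
by apply: comp_foldr; [by []|comp_var|apply: comp_succn; comp_var].
Qed.

Lemma comp_bigmax {A B C} {cA : coded A} {cB : coded B} {cC : coded C}
    (F : A -> seq C) (g : A -> C -> nat) :
  computable F -> computable (fun x : A * C => g x.1 x.2) ->
  computable (fun a => \max_(c <- F a) g a c).
Proof.
move=> cF cg.
apply: (comp_ext (F := fun a => foldr (fun c n => maxn (g a c) n) 0 (F a))).
  by move=> a; elim: (F a) => [|x s /= ->]; rewrite ?big_nil ?big_cons.
apply: comp_foldr; [by []|comp_var|apply: comp_maxn; last comp_var].
by refine (comp_comp2 cg _ _); comp_var.
Qed.

Lemma comp_nth {A C} {cA : coded A} {cC : coded C} (x0 : C)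
    (F : A -> seq C) (G : A -> nat) :
  computable F -> computable G -> computable (fun a => nth x0 (F a) (G a)).
Proof.
move=> cF cG.
apply: (comp_ext (F := fun a =>
    if iter (G a) behead (F a) is x :: _ then x else x0)).
  move=> a; rewrite -[G a in RHS]addn0 -nth_drop.
  have -> : drop (G a) (F a) = iter (G a) behead (F a).
    by elim: (G a) => [|n IH]; rewrite ?drop0 //= -IH -drop1 drop_drop add1n.
  by case: (iter _ _ _).
apply: comp_seq; [|comp_var|comp_var].
apply: comp_iter => //.
apply: (comp_comp (g := behead)); last comp_var.
by apply: (comp_expr (e := ETl EVar)); case.
Qed.

(** A function on a finite type is a table, here the constant list [codom g], and the code of an
    argument is its index in that table. *)
Lemma comp_fin {A B : Type} {cA : coded A} {cB : coded B} (T : finType)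
    (F : A -> T) (g : T -> B) :
  computable F -> computable (fun a => g (F a)).
Proof.
(* If [T] is empty then so is [A], because of [F], and any command will do. *)
move=> cF; have [b0 _|T0] := pickP T; last first.
  by exists (Assign EVar) => a; move: (T0 (F a)).
apply: (comp_ext (F := fun a => nth (g b0) (codom g) (enum_rank (F a)))).
  by move=> a; rewrite (nth_map b0) ?nth_enum_rank -?cardE.
apply: comp_nth; first exact: comp_cst.
apply: (comp_comp (g := fun x : T => nat_of_ord (enum_rank x)) _ cF).
exact: (comp_expr (e := EVar)).
Qed.

(** * Unbounded minimization *)

(** The loop state carries the value of [P] at the counter, so the guard only reads a component. The
    second clause yields divergence when no counter falsifies [P]. *)
Lemma exec_minimize {A B} {cA : coded A} {cB : coded B}
    (P : A -> nat -> bool) (G : A -> nat -> B) :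
  computable (fun x => P x.1 x.2) -> computable (fun x => G x.1 x.2) ->
  exists C, forall a,
    (forall n, ~~ P a n -> (forall k, k < n -> P a k) ->
       exec C (code a) (code (G a n))) /\
    (forall d, exec C (code a) d -> exists n, ~~ P a n).
Proof.
move=> cP [CG EG].
have [D ED] : computable (fun x : A * nat => (P x.1 x.2, x)).
  by apply: comp_pair => //; apply: comp_id.
have {}ED a n : exec D (Cons (code a) (code n)) (code (P a n, (a, n))) := ED (a, n).
pose next := Assign (ECons (EHd (ETl EVar)) (ECons ENil (ETl (ETl EVar)))).
pose loop := While (EHd EVar) (Seq next D).
exists (Seq (Assign (ECons EVar ENil))
  (Seq D (Seq loop (Seq (Assign (ETl EVar)) CG)))).
pose state (a : A) (n : nat) :=
  Cons (coded_bool (P a n)) (Cons (cA a) (coded_nat n)).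
have Enext a n : exec (Seq next D) (state a n) (state a n.+1).
  by apply: ExecSeq (ED a n.+1); apply: exec_assign.
move=> a; split=> [n nPn Pk|d].
  apply: ExecSeq; first exact: ExecAssign.
  apply: ExecSeq; first exact: (ED a 0).
  apply: (@ExecSeq _ _ _ (state a n)); last first.
    by apply: ExecSeq (EG (a, n)); apply: exec_assign.
  (* Induction on the number [m] of rounds left before the counter reaches [n]. *)
  suff H m : m <= n -> exec loop (state a (n - m)) (state a n).
    by have := H n (leqnn _); rewrite subnn.
  elim: m => [_|m IH mn].
    by rewrite subn0; apply: ExecWhileStop; rewrite /= (negbTE nPn).
  apply: ExecWhileLoop (IH (ltnW mn)); first by rewrite /= Pk ?ltn_subrL //; lia.
  by have := Enext a (n - m.+1); rewrite subnSK.
move=> /exec_seqE[u E1 /exec_seqE[x ED0 /exec_seqE[y EL _]]].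
have {E1 ED0} Ex : x = state a 0.
  by apply: exec_det ED0 _; rewrite -(exec_det (ExecAssign _ _) E1); apply: (ED a 0).
(* The loop becomes a variable with an equation, so that induction on the derivation remembers which
   command runs; the counter is generalized from 0. *)
have [C EC] : exists C, C = loop by exists loop.
move: EL; rewrite -EC => EL; elim: EL 0 Ex EC => //.
  move=> e C' z ez n zE [ee _]; move: ez; rewrite ee zE /= => ez.
  by exists n; case: (P a n) ez.
move=> e C' z z1 z2 _ Ez _ _ IH n zE [ee CE].
apply: (IH n.+1); last by rewrite ee CE.
by apply: exec_det Ez _; rewrite zE CE; apply: Enext.
Qed.

(** * Search for the first word satisfying a decidable condition *)

Section Search.
Variables (A : Type) (cA : coded A) (T : finType) (cT : coded T).
Variables (Q : A -> seq T -> bool) (le : rel (seq T)).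
Hypothesis cQ : computable (fun x => Q x.1 x.2).
Hypothesis cle : computable (fun x => le x.1 x.2).

Definition words_of_size (n : nat) : seq (seq T) :=
  iter n (fun w => [seq x :: s | x <- enum T, s <- w]) [:: [::]].

Lemma mem_words_of_size n s : (s \in words_of_size n) = (size s == n).
Proof.
elim: n s => [|n IH] s; first by rewrite inE; case: s.
apply/allpairsP/eqP => [[[x t] /= [_ +] ->]|].
  by rewrite IH /= => /eqP ->.
case: s => // x s [] sn; exists (x, s) => /=.
by rewrite mem_enum; split=> //; rewrite IH sn.
Qed.

Lemma comp_words_of_size {D} {cD : coded D} (F : D -> nat) :
  computable F -> computable (fun a => words_of_size (F a)).
Proof.
move=> cF; apply: comp_iter => //; first exact: comp_cst.
apply: comp_flatten; apply: comp_map; first exact: comp_cst.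
by apply: comp_map; [|apply: comp_cons]; comp_var.
Qed.

Definition candidates (a : A) (n : nat) : seq (seq T) :=
  [seq s <- words_of_size n | Q a s].

(** Minimality is tested among candidates of one length only, which is a finite check. *)
Definition least_candidates (a : A) (n : nat) : seq (seq T) :=
  [seq s <- candidates a n | all (le s) (candidates a n)].

(** The classical case distinction only specifies the value; the computation minimizes over lengths
    and diverges in the case [None]. *)
Definition search (a : A) : option (seq T) :=
  match excluded_middle_informative (exists n, ~~ nilp (least_candidates a n)) with
  | left e => ohead (least_candidates a (ex_minn e))
  | right _ => None
  end.

Lemma mem_least_candidates a n s :
  s \in least_candidates a n ->
  [/\ Q a s, size s = n & forall t, size t = n -> Q a t -> le s t].
Proof.
rewrite !mem_filter mem_words_of_size => /and3P[/allP les Qs /eqP sn].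
split=> // t tn Qt.
by apply: les; rewrite mem_filter mem_words_of_size Qt tn /=.
Qed.

(** Since [s] is also shortest, no smaller length has candidates, and the search stops at the length
    of [s]. Antisymmetry is asked only against [s], because [le] need not be an order on all
    words. *)
Lemma search_first a s :
  Q a s -> (forall t, Q a t -> le s t /\ size s <= size t) ->
  (forall t, Q a t -> le t s -> t = s) -> search a = Some s.
Proof.
move=> Qs s_le s_anti.
have sN : ~~ nilp (least_candidates a (size s)).
  have : s \in least_candidates a (size s).
    rewrite !mem_filter mem_words_of_size Qs eqxx !andbT.
    by apply/allP => t; rewrite mem_filter => /andP[/s_le[]].
  by case: (least_candidates _ _).
rewrite /search; case: excluded_middle_informative => [e|[]];
  last by exists (size s).
case: ex_minnP => n nN n_min.
case E: (least_candidates a n) nN => [//|t l] _ /=.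
have : t \in least_candidates a n by rewrite E inE eqxx.
move=> /mem_least_candidates[Qt tn t_le].
congr Some; apply: s_anti => //; apply: t_le => //.
by apply/eqP; rewrite eqn_leq -{1}tn (s_le t Qt).2 n_min.
Qed.

(** The least candidates of a given length form a computable list; minimization over lengths halts
    exactly when one of these lists is nonempty. *)
Lemma search_computable :
  exists C, forall a d, exec C (code a) d <-> omap code (search a) = Some d.
Proof.
have cC D (cD : coded D) (F : D -> A) (G : D -> nat) :
    computable F -> computable G -> computable (fun x => candidates (F x) (G x)).
  move=> cF cG; apply: comp_filter; first exact: comp_words_of_size.
  refine (comp_comp2 cQ _ _); last comp_var.
  by apply: comp_comp => //; comp_var.
have cL : computable (fun x : A * nat => least_candidates x.1 x.2).
  apply: comp_filter; first by apply: cC; comp_var.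
  apply: comp_all; first by apply: cC; comp_var.
  by refine (comp_comp2 cle _ _); comp_var.
have [||C HC] := @exec_minimize A (seq T) _ _
    (fun a n => nilp (least_candidates a n))
    (fun a n => head [::] (least_candidates a n)).
- by apply: comp_eqn; [apply: comp_size | comp_var].
- apply: (comp_ext (F := fun x =>
    if least_candidates x.1 x.2 is s :: _ then s else [::])).
    by move=> x; case: (least_candidates _ _).
  by apply: comp_seq => //; comp_var.
exists C => a d; have [H1 H2] := HC a.
have [[y [Ey dy]]|[En dn]] :
    (exists y, search a = Some y /\ exec C (code a) (code y)) \/
    (search a = None /\ forall d, ~ exec C (code a) d).
- rewrite /search; case: excluded_middle_informative => [e|ne]; last first.
    by right; split=> // d' /H2.
  left; case: ex_minnP => n nN n_min; exists (head [::] (least_candidates a n)).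
  split; first by case: (least_candidates a n) nN.
  by apply: H1 => // k; rewrite ltnNge; apply: contraNT; apply: n_min.
- by rewrite Ey /=; split=> [Ed|[<-]//]; rewrite (exec_det Ed dy).
- by rewrite En; split=> // /dn.
Qed.

End Search.

(* The bijective base-[m] numeral with digits [r a + 1]: the position of [s] in
   the order by length, then lexicographic. *)
Definition posn (T : Type) (m : nat) (r : T -> nat) (s : seq T) : nat :=
  foldl (fun v a => m * v + (r a).+1) 0 s.

(** * Positions of words: order, injectivity and growth *)

Section Position.
Variables (T : Type) (m : nat) (r : T -> nat).
Notation posn := (posn m r).

Lemma posn_rcons s a : posn (rcons s a) = m * posn s + (r a).+1.
Proof. by rewrite /posn foldl_rcons. Qed.

Lemma posn_cons a s : posn (a :: s) = (r a).+1 * m ^ size s + posn s.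
Proof.
rewrite -cat1s; elim/last_ind: s => [|s b IH].
  by rewrite /posn /= muln0 muln1 addn0.
by rewrite -rcons_cat !posn_rcons IH size_rcons expnS mulnDr addnA mulnCA.
Qed.

Lemma comp_posn {A} {cA : coded A} {cT : coded T} (F : A -> seq T) :
  computable r -> computable F -> computable (fun a => posn (F a)).
Proof.
move=> cr cF; apply: comp_foldl => //; first exact: comp_cst.
apply: comp_addn; first by apply: comp_muln; comp_var.
by apply: comp_succn; apply: comp_comp => //; comp_var.
Qed.

Hypothesis r_lt : forall a, r a < m.

(** By induction the prefixes differ by at least one, which is worth [m] after multiplication, and
    the last digit of the shorter word is at most [m]. *)
Lemma posn_lt_size p q : size p < size q -> posn p < posn q.
Proof.
elim/last_ind: p q => [|p a IH] q; elim/last_ind: q => [|q b _] //.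
  by rewrite posn_rcons addnS.
rewrite !size_rcons !posn_rcons ltnS => /IH pq.
have := leq_mul (leqnn m) pq; have := r_lt a; rewrite mulnS; lia.
Qed.

(** This keeps a tail from outweighing a difference in the first digit. *)
Lemma posn_lt_same_size p q : size p = size q -> posn p < posn q + m ^ size p.
Proof.
elim: p q => [|a p IH] [|b q] //= [pq]; rewrite !posn_cons -pq expnS.
have := leq_mul (r_lt a) (leqnn (m ^ size p)); have := IH q pq.
rewrite !mulSn; move: (r a * _) (r b * _) (m * _) => u v w.
move: (m ^ _) (posn p) (posn q) => M x y; lia.
Qed.

(** One less than a nonempty numeral is [m * posn s + r a], whose quotient and remainder by [m]
    recover the prefix and the last digit. *)
Lemma posn_inj : injective r -> injective posn.
Proof.
move=> rI; elim/last_ind => [|p a IH] q; elim/last_ind: q => [|q b _] //.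
- by rewrite posn_rcons addnS.
- by rewrite posn_rcons addnS.
rewrite !posn_rcons !addnS !(mulnC m) => -[E].
have m0 : 0 < m by apply: leq_trans (r_lt a).
have := congr1 (divn^~ m) E; rewrite /= !divnMDl // !divn_small // !addn0 => /IH <-.
by have := congr1 (modn^~ m) E; rewrite /= !modnMDl !modn_small // => /rI ->.
Qed.

(** The surplus of two carries the induction: multiplied by [m] it gives [2 * m], enough for a new
    digit of at most [m] and for two again, as [m] is at least two. *)
Lemma posn_bound s : 1 < m -> (posn s).+2 <= 2 * m ^ size s.
Proof.
move=> m1; elim/last_ind: s => [|s a IH] //; rewrite posn_rcons size_rcons expnS.
have := leq_mul (leqnn m) IH; have := r_lt a; rewrite !mulnS mulnCA.
by move: (m * _) (m * _) => x y; lia.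
Qed.

End Position.

(** The digits of a positive number are found from the last one by halving its predecessor. A
    position thus gets a description of logarithmic size. *)
Lemma posn_bool_surj n :
  exists2 q, posn 2 nat_of_bool q = n & 2 ^ size q <= n.+1.
Proof.
have [k] := ubnP n; elim: k n => // k IH [|n] nk; first by exists [::].
have [|q Eq sq] := IH n./2; first lia.
have := odd_double_half n; exists (rcons q (odd n)).
  by rewrite posn_rcons Eq; lia.
by rewrite size_rcons expnS; lia.
Qed.

(** * The program order as comparison of positions *)

Section ProgramOrder.
Variables (disp : Order.disp_t) (Ups : finOrderType disp).

(** Counting smaller instructions follows the order on [Ups], which [enum_rank] need not do. *)
Definition instr_rank (a : Ups) : nat := #|[pred b : Ups | (b < a)%O]|.

Lemma instr_rank_lt a : instr_rank a < #|Ups|.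
Proof.
apply: proper_card; apply/properP; split; first exact/subsetP.
by exists a; rewrite // inE Order.POrderTheory.ltxx.
Qed.

Lemma instr_rank_mono a b : (a < b)%O -> instr_rank a < instr_rank b.
Proof.
move=> ab; apply: proper_card; apply/properP; split.
  by apply/subsetP => c; rewrite !inE => /Order.POrderTheory.lt_trans; apply.
by exists a; rewrite ?inE ?Order.POrderTheory.ltxx.
Qed.

Lemma instr_rank_inj : injective instr_rank.
Proof.
move=> a b; case: (Order.TotalTheory.ltgtP a b) => // /instr_rank_mono + E;
  by rewrite E ltnn.
Qed.

Definition prog_pos : seq Ups -> nat := posn #|Ups| instr_rank.

(** Through positions the program order is seen to be antisymmetric, well founded and computable. *)
Lemma prog_leE p q : prog_le p q = (prog_pos p <= prog_pos q).
Proof.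
rewrite /prog_le; case: (ltngtP (size p) (size q)) => /= [pq|pq|pq].
- by rewrite ltnW // posn_lt_size //; apply: instr_rank_lt.
- by apply/esym/negbTE; rewrite -ltnNge posn_lt_size //; apply: instr_rank_lt.
rewrite /prog_pos; elim: p q pq => [|a p IH] [|b q] //= [pq].
rewrite Order.SeqLexiOrder.Exports.lexi_cons !posn_cons -pq.
(* A larger first rank adds at least one full block [#|Ups| ^ size s], more than the tail can make
   up for. *)
have lt_pos c d s t : instr_rank c < instr_rank d -> size s = size t ->
    (instr_rank c).+1 * #|Ups| ^ size s + posn #|Ups| instr_rank s <
    (instr_rank d).+1 * #|Ups| ^ size s + posn #|Ups| instr_rank t.
  move=> cd /(posn_lt_same_size instr_rank_lt).
  have := leq_mul cd (leqnn (#|Ups| ^ size s)); rewrite (mulSn (instr_rank d)).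
  move: (posn _ _ s) (posn _ _ t) => x y.
  move: (_.+1 * _) (instr_rank d * _) => u v; move: (_ ^ _) => w; lia.
case: (Order.TotalTheory.ltgtP a b)
  => /= [/instr_rank_mono ab|/instr_rank_mono ba|->].
- by apply/esym/ltnW/lt_pos.
- by apply/esym/negbTE; rewrite -ltnNge {1 2}pq; apply: lt_pos.
by rewrite IH // leq_add2l.
Qed.

Lemma comp_prog_pos {A} {cA : coded A} (F : A -> seq Ups) :
  computable F -> computable (fun a => prog_pos (F a)).
Proof. 
move=> cF; apply: comp_posn => //.
exact: (comp_fin instr_rank comp_id).
Qed.

End ProgramOrder.

(** Binary positions are injective, so words can be compared as numbers. *)
Lemma comp_eq_option_word {A} {cA : coded A} (F G : A -> option word) :
  computable F -> computable G -> computable (fun a => F a == G a).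
Proof.
move=> cF cG; have ltb (b : bool) : b < 2 by case: b.
have bI := posn_inj (m := 2) (r := nat_of_bool) ltb (can_inj oddb).
pose v := posn 2 nat_of_bool.
have cv B (cB : coded B) (H : B -> word) :
    computable H -> computable (fun b => v (H b)).
  move=> cH; apply: comp_posn => //.
  apply: (comp_ext (F := fun b : bool => if b then 1 else 0)); first by case.
  by apply: comp_if; comp_var.
apply: (comp_ext (F := fun a => if F a is Some s then
    if G a is Some t then v s == v t else false else
    if G a is Some _ then false else true)).
  by move=> a; case: (F a) (G a) => [s|] [t|] //; rewrite (inj_eq bI).
apply: comp_option => //; last by apply: comp_option => //; comp_var.
apply: comp_option; [|apply: comp_eqn; apply: cv; comp_var|comp_var].
by apply: comp_comp => //; comp_var.
Qed.

(** * The learner as a total computable function *)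

Section Learner.
Variables (disp : Order.disp_t) (Ups : finOrderType disp) (L : language Ups).
Variables (f : nat -> nat) (f_computable : computable f).

(** This is the list that [coded_exset] encodes, so passing to it leaves the code unchanged. *)
Definition listing (S : exset) : seq example := sort input_le (enum_fset S).

Definition compatibleb (S : exset) (p : seq Ups) : bool :=
  all (fun x => run L p x.1 (maxn (f (size x.1)) (lookup_time (rho L) x.1 S)) == x.2)
    (listing S).

Lemma compatibleP S p : reflect (compatible L f p S) (compatibleb S p).
Proof.
apply: (iffP allP) => [H i o io|H [i o]].
  by apply/eqP/(H (i, o)); rewrite mem_sort.
by rewrite mem_sort => io; apply/eqP/H.
Qed.

Lemma comp_listing : computable listing.
Proof. exact: (comp_expr (e := EVar)). Qed.

Lemma comp_lookup_time {A} {cA : coded A} n (F : A -> word) (G : A -> exset) :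
  computable F -> computable G -> computable (fun a => lookup_time n (F a) (G a)).
Proof.
move=> cF cG.
(* Maxima are invariant under permutation, so the sorted listing contained in the code may be
   used. *)
apply: (comp_ext (F := fun a =>
    n * minn (size (F a)) (\max_(x <- listing (G a)) size x.1) +
    \max_(x <- listing (G a)) size (odflt [::] x.2))).
  move=> a; rewrite /lookup_time /imax /omax.
  by rewrite !(perm_big _ (permEl (perm_sort _ _))).
have cL : computable (fun a => listing (G a)) by apply: comp_comp comp_listing cG.
apply: comp_addn; [apply: comp_muln; [comp_var|apply: comp_minn]|].
- exact: comp_size.
- by apply: comp_bigmax => //; apply: comp_size; comp_var.
- apply: comp_bigmax => //; apply: comp_size.
  by apply: comp_option; comp_var.
Qed.

Definition fits (S : exset) (p : seq Ups) : bool :=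
  is_program L p && compatibleb S p.

(** Every run is clocked by a computable bound, so even an output [None] is checked in finite
    time. *)
Lemma comp_fits : computable (fun x => fits x.1 x.2).
Proof.
apply: comp_andb.
  by apply: comp_comp; [apply: is_program_computable | comp_var].
apply: comp_all; first by apply: comp_comp comp_listing _; comp_var.
apply: comp_eq_option_word; last comp_var.
apply: (comp_comp (F := fun y : (exset * seq Ups) * example => (y.1.2, y.2.1,
   maxn (f (size y.2.1)) (lookup_time (rho L) y.2.1 y.1.1))) (run_computable L)).
apply: comp_pair; first by apply: comp_pair; comp_var.
apply: comp_maxn; last by apply: comp_lookup_time; comp_var.
by apply: comp_comp => //; apply: comp_size; comp_var.
Qed.

Lemma learner_first S p :
  learner L f S p <-> fits S p /\ forall q, fits S q -> prog_le p q.
Proof.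
split=> [[[Pp cp] H]|[/andP[Pp /compatibleP cp] H]].
  split; first by rewrite /fits Pp; apply/compatibleP.
  by move=> q /andP[Pq /compatibleP cq]; apply: H.
by split=> // q [Pq cq]; apply: H; rewrite /fits Pq; apply/compatibleP.
Qed.

(** The lookup program fits, since its outputs persist under the larger time bound; descent on
    positions then reaches a first program. *)
Lemma learner_exists S : exists p, learner L f S p.
Proof.
have [p Pp Hp] := lookup_program L S.
have : fits S p.
  rewrite /fits Pp; apply/compatibleP => i o /Hp; case: o => [y|-> //].
  by apply: run_monotone; apply: leq_maxr.
have [n] := ubnP (prog_pos p); elim: n p {Pp Hp} => // n IH p pn fp.
have [[q fq qp]|no] := classic (exists2 q, fits S q & prog_pos q < prog_pos p).
  by apply: IH fq; apply: leq_trans qp _.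
exists p; apply/learner_first; split=> // q fq; rewrite prog_leE leqNgt.
by apply/negP => qp; apply: no; exists q.
Qed.

Definition learn (S : exset) : seq Ups :=
  odflt [::] (search fits (@prog_le _ Ups) S).

(** The order compares lengths first, so the first fitting program is also a shortest one and the
    search finds it. The default value in [learn] is therefore never reached. *)
Lemma learnP S :
  search fits (@prog_le _ Ups) S = Some (learn S) /\ learner L f S (learn S).
Proof.
have [p Hp] := learner_exists S; have [fp p_le] := (learner_first S p).1 Hp.
suff E : search fits (@prog_le _ Ups) S = Some p by rewrite /learn E.
apply: search_first => // [q fq|q fq].
  split; first exact: p_le.
  by have /orP[/ltnW|/andP[/eqP->]] := p_le q fq.
rewrite prog_leE => qp; have := p_le q fq; rewrite prog_leE => pq.
by apply/(posn_inj (@instr_rank_lt _ _) (@instr_rank_inj _ _))/eqP; rewrite eqn_leq qp.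
Qed.

Lemma learner_learn S p : learner L f S p -> learn S = p.
Proof.
move=> /learner_first[fp p_le]; have [_ /learner_first[fl l_le]] := learnP S.
apply/(posn_inj (@instr_rank_lt _ _) (@instr_rank_inj _ _))/eqP.
by rewrite eqn_leq -!/(prog_pos _) -!prog_leE p_le ?l_le.
Qed.

Lemma learn_computable : computable learn.
Proof.
have [|C HC] := search_computable comp_fits (le := @prog_le _ Ups).
  apply: (comp_ext (F := fun x => prog_pos x.1 <= prog_pos x.2)).
    by move=> x; rewrite prog_leE.
  by apply: comp_leq; apply: comp_prog_pos; comp_var.
by exists C => S; apply/HC; rewrite (learnP S).1.
Qed.

End Learner.

(** * Bounds on Kolmogorov complexity from computable decoders *)

Lemma K_le_size (U : universal_machine) q x : U q = Some x -> K U x <= size q.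
Proof.
move=> Uq; rewrite /K; case: ex_minnP => n _; apply.
by apply/existsP; exists (in_tuple q); rewrite Uq.
Qed.

Lemma K_le_description (U : universal_machine) phi : pcomputable phi ->
  exists c, forall q x, phi q = Some x -> K U x <= size q + c.
Proof.
move=> /(machine_universal U)[c Hc]; exists c => q x /Hc[q' Uq'].
exact/leq_trans/K_le_size.
Qed.

Lemma computable_pcomputable (g : word -> word) :
  computable g -> pcomputable (fun q => Some (g q)).
Proof.
move=> [C EC]; exists C => i d; split=> [Ed|[<-]//].
by rewrite /= (exec_det Ed (EC i)).
Qed.

Lemma comp_program_bits disp (Ups : finOrderType disp) {A} {cA : coded A}
    (F : A -> seq Ups) :
  computable F -> computable (fun a => program_bits (F a)).
Proof.
move=> cF; apply: comp_flatten; apply: comp_map => //.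
by refine (comp_fin (@instr_bits _ Ups) _); comp_var.
Qed.

(** Take logarithms to base two; the factor 2 becomes the additional bit. *)
Lemma size_le_ell disp (Ups : finOrderType disp) (p : seq Ups) (q : word) :
  1 < #|Ups| -> 2 ^ size q <= 2 * #|Ups| ^ size p ->
  (INR (size q) <= ell p + 1)%coqR.
Proof.
move=> m1 /leP/le_INR; rewrite !mulnE -?multE mult_INR.
have INR_exp a b : INR (a ^ b) = (INR a ^ b)%coqR.
  by elim: b => // b IH; rewrite expnS -multE mult_INR IH.
rewrite !INR_exp /ell => H.
have m0 : (0 < INR #|Ups|)%coqR by apply: lt_0_INR; apply/ltP; apply: ltn_trans m1.
have t0 : (0 < INR 2)%coqR by apply: lt_0_INR; apply/ltP.
have l2 : (0 < ln 2)%coqR by have := ln_lt_2; lra.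
have : (ln (INR 2 ^ size q) <= ln (INR 2 * INR #|Ups| ^ size p))%coqR.
  case: H => [H|->]; last exact: Rle_refl.
  by apply/Rlt_le/ln_increasing => //; apply: pow_lt.
rewrite ln_mult //; last exact: pow_lt.
rewrite !ln_pow // => {}H.
apply: (Rmult_le_reg_r (ln 2)) => //.
have -> : ((INR (size p) * (ln (INR #|Ups|) / ln 2) + 1) * ln 2 =
  ln 2 + INR (size p) * ln (INR #|Ups|))%coqR by field; lra.
exact: H.
Qed.

Theorem proposition1 (disp : Order.disp_t) (Ups : finOrderType disp)
    (L : language Ups) (E : prefix_code) (O : example_order E)
    (U : universal_machine) (f : nat -> nat) (f_computable : computable f) :
  exists k1 k2 : nat, forall (w : exset) (p : seq Ups),
    teaching_book L O f w p ->
    (K U (program_bits p) <= delta E w + k1)%N /\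
    (INR (K U (enc E w)) <= ell p + INR k2)%coqR.
Proof.
have c_learn := learn_computable L f_computable.
have cdec := dec_computable E.
(* The first decoder maps a code word to the program learnt from its set; the value [[::]] on other
   words is arbitrary. *)
have [|k1 Hk1] := @K_le_description U
    (fun q => Some (if dec E q is Some w then program_bits (learn L f w) else [::])).
  apply: computable_pcomputable; apply: comp_option => //; last by comp_var.
  by apply: comp_program_bits; apply: comp_comp => //; comp_var.
(* For the second decoder, [q] is the binary numeral of a program position, and [s] must be a code
   word of a set from which that program is learnt. *)
pose Q (q s : word) :=
  if dec E s is Some w then prog_pos (learn L f w) == posn 2 nat_of_bool q
  else false.
(* The order [O] carried over to code words; the value [false] elsewhere is harmless, as all
   candidates are code words. *)
pose le (s t : word) :=
  if dec E s is Some w then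
    if dec E t is Some w' then O w w' else false
  else false.
have cQ : computable (fun x => Q x.1 x.2).
  apply: comp_option; [by apply: comp_comp cdec _; comp_var| |by comp_var].
  apply: comp_eqn; first by apply: comp_prog_pos; apply: comp_comp => //; comp_var.
  apply: comp_posn; last by comp_var.
  apply: (comp_ext (F := fun b : bool => if b then 1 else 0)); first by case.
  by apply: comp_if; comp_var.
have cle : computable (fun x => le x.1 x.2).
  apply: comp_option; [by apply: comp_comp cdec _; comp_var| |by comp_var].
  apply: comp_option; [by apply: comp_comp cdec _; comp_var| |by comp_var].
  apply: (comp_comp (F := fun y : (word * word) * exset * exset => (y.1.2, y.2))
    (exle_computable O)).
  by apply: comp_pair; comp_var.
have [c Hc] := K_le_description U (search_computable cQ cle).
(* [c] is the cost of simulating the search, and the one extra bit pays for the factor 2 in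
   [posn_bound]. *)
exists k1, c.+1 => w p [g [[_ w_le] lw pg]]; split.
  by apply: Hk1; rewrite encK (learner_learn lw).
have [q qp q_size] := posn_bool_surj (prog_pos p).
(* A set from which [p] is learnt teaches the same concept [g], so the teacher ranks [w] before
   it. *)
have w_first t : Q q t -> exists S, [/\ dec E t = Some S, enc E S = t & O w S].
  have := decK E t; rewrite /Q; case: (dec E t) => [S /= St|//]; rewrite qp.
  move=> /eqP/(posn_inj (@instr_rank_lt _ _) (@instr_rank_inj _ _)) lS.
  exists S; split=> //; apply: w_le; exists p => //.
  by rewrite -lS; apply: (learnP _ _ _).2.
(* By [exle_delta] the code word of [w] is also shortest among the candidates, as the search by
   length requires. *)
have Eq : search Q le q = Some (enc E w).
  apply: search_first; first by rewrite /Q encK (learner_learn lw) qp.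
  - move=> t /w_first[S [tS <- wS]]; rewrite /le !encK.
    by split=> //; apply: exle_delta wS.
  move=> t /w_first[S [tS <- wS]]; rewrite /le !encK => Sw.
  by congr enc; apply: (exle_anti (e := O)); rewrite Sw.
have q_le : (INR (size q) <= ell p + 1)%coqR.
  apply: size_le_ell (instr_gt1 L) _; apply: leq_trans q_size _.
  by apply: leq_trans (posn_bound (@instr_rank_lt _ _) p (instr_gt1 L)).
have /leP/le_INR := Hc _ _ Eq; rewrite -plusE plus_INR S_INR; lra.
Qed.
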